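(* There does not exist any bounded smooth immersed minimal hypersurface with free boundary on a cone.
   Context: Points of $\mathbb{R}^{n+1}$, $n\ge2$, are written $(x,z)$, $x\in\mathbb{R}^n$, $z\in\mathbb{R}$; $Oz$ is the $z$-axis. A cone is the support hypersurface of revolution $F_\Sigma(\Sigma)=\{(x,z):|x|=\omega_\Sigma(z),\ z\ne0\}$ with profile function $\omega_\Sigma(z)=c|z|$, $c>0$ (an embedded double cone with its vertex at the origin). Its unit normal $\nu_\Sigma$ points away from the interior of the hypersurfaces supported on it. Minimal hypersurface with free boundary on $F_\Sigma$: a smooth immersion $F:M^n\to\mathbb{R}^{n+1}$ of an $n$-dimensional manifold $M$ with boundary $\partial M$, with mean curvature $H\equiv0$, $F(\partial M)\subset F_\Sigma(\Sigma)$ and $\langle\nu,\nu_\Sigma\rangle=0$ along $\partial M$, where $\nu$ is the unit normal of $F$. No assumption on topology, symmetry or graphicality is made. Bounded means that $F(M)$ is a bounded set.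
   Formalization: The hypersurface is nonempty and its image F(M) is also assumed closed (automatic if M is compact or F is proper); otherwise a small open flat disc with empty boundary, or a small flat half-disc in a hyperplane containing Oz with its edge on the cone, is a counterexample. *)

(* Defs.v *)
(* MathComp-Analysis; the real line is an arbitrary R : realType. *)
From HB Require Import structures.
From mathcomp Require Import all_boot all_order all_algebra.
From mathcomp Require Import all_classical all_reals all_analysis.

Set Implicit Arguments.
Unset Strict Implicit.
Unset Printing Implicit Defensive.

Import Order.TTheory GRing.Theory Num.Theory.
Import numFieldNormedType.Exports.

Local Open Scope classical_set_scope.
Local Open Scope ring_scope.

(* Points (x, z) of R^(n+1). The library norms on 'rV_n and on products are
   sup norms: they are used only for topology and differentiability, the
   Euclidean structure being given by dotv, dot and enorm below. *)
Notation ambient R n := ('rV[R]_n * R)%type.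

Definition dotv (R : realType) (n : nat) (x y : 'rV[R]_n) : R :=
  \sum_(i < n) x 0 i * y 0 i.

Definition enorm (R : realType) (n : nat) (x : 'rV[R]_n) : R :=
  Num.sqrt (dotv x x).

Definition dot (R : realType) (n : nat) (p q : ambient R n) : R :=
  dotv p.1 q.1 + p.2 * q.2.

(* g is C^infinity near u: every iterated directional derivative of g is
   (Frechet) differentiable at all points of a neighbourhood of u. *)
Definition smooth_near (R : realType) (V W : normedModType R)
    (g : V -> W) (u : V) : Prop :=
  \forall v \near u, forall es : seq V,
    differentiable (foldr (fun (e : V) (h : V -> W) => 'D_e h) g es) v.

(* Smoothness on a subset A that need not be open (relatively open subsets of
   a half-space are meant) is the local existence of smooth extensions. *)
Definition smooth_extension (R : realType) (V W : normedModType R)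
    (A : set V) (f : V -> W) (u : V) (g : V -> W) : Prop :=
  smooth_near g u /\ (\forall v \near u, A v -> g v = f v).

Definition smooth_on (R : realType) (V W : normedModType R)
    (A : set V) (f : V -> W) : Prop :=
  forall u, A u -> exists g, smooth_extension A f u g.

(* The quantifier over i only serves to speak of the first coordinate for a
   general n. *)
Definition half_space (R : realType) (n : nat) : set 'rV[R]_n :=
  [set u | forall i : 'I_n, i = 0%N :> nat -> 0 <= u 0 i].

Definition half_space_boundary (R : realType) (n : nat) : set 'rV[R]_n :=
  [set u | exists2 i : 'I_n, i = 0%N :> nat & u 0 i = 0].

(* cmap and cinv are total functions, meaningful only on cdom and on its
   image respectively. *)
Record chart (R : realType) (n : nat) (M : topologicalType) := Chart {
  cdom : set M;
  cmap : M -> 'rV[R]_n;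
  cinv : 'rV[R]_n -> M;
  cdom_open : open cdom;
  cimg_open : exists2 W : set 'rV[R]_n, open W &
    cmap @` cdom = W `&` @half_space R n;
  cmapK : forall p, cdom p -> cinv (cmap p) = p;
  cmap_continuous : {within cdom, continuous cmap};
  cinv_continuous : {within cmap @` cdom, continuous cinv}
}.

Definition cimg (R : realType) (n : nat) (M : topologicalType)
    (phi : chart R n M) : set 'rV[R]_n := cmap phi @` cdom phi.

Record manifold (R : realType) (n : nat) := Manifold {
  carrier :> topologicalType;
  carrier_hausdorff : hausdorff_space carrier;
  carrier_second_countable : @second_countable carrier;
  atlas : set (chart R n carrier);
  atlas_cover : forall p : carrier, exists2 phi, atlas phi & cdom phi p;
  atlas_smooth : forall phi psi, atlas phi -> atlas psi ->
    smooth_on (cmap phi @` (cdom phi `&` cdom psi)) (cmap psi \o cinv phi)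
}.

Definition mboundary (R : realType) (n : nat) (M : manifold R n) : set M :=
  [set p | exists phi : chart R n M,
     [/\ atlas phi, cdom phi p & half_space_boundary (cmap phi p)]].

Definition smooth_map (R : realType) (n : nat) (M : manifold R n)
    (W : normedModType R) (F : M -> W) : Prop :=
  forall phi : chart R n M, atlas phi -> smooth_on (cimg phi) (F \o cinv phi).

(* g is a local parametrization of F near p: F read in a chart phi around p
   and extended smoothly across the boundary of the half-space when p is a
   boundary point. The derivatives of g at u = phi(p) depend only on F and
   phi, since the half-space is the closure of its interior. *)
Definition local_param (R : realType) (n : nat) (M : manifold R n)
    (F : M -> ambient R n) (p : M) (g : 'rV[R]_n -> ambient R n)
    (u : 'rV[R]_n) : Prop :=
  exists phi : chart R n M,
    [/\ atlas phi, cdom phi p, u = cmap phi p &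
        smooth_extension (cimg phi) (F \o cinv phi) u g].

Definition immersion (R : realType) (n : nat) (M : manifold R n)
    (F : M -> ambient R n) : Prop :=
  smooth_map F /\
  forall p g u, local_param F p g u -> injective ('d g u).

Section LocalGeometry.
Variables (R : realType) (n : nat) (g : 'rV[R]_n -> ambient R n) (u : 'rV[R]_n).

Definition partial (W : normedModType R) (i : 'I_n) (h : 'rV[R]_n -> W) :
  'rV[R]_n -> W := 'D_(delta_mx 0 i) h.

(* There are two unit normals, nu and - nu. No orientation is assumed, so the
   conditions H = 0 and <nu, nu_Sigma> = 0, which do not depend on the choice,
   are required below of every unit normal. *)
Definition unit_normal (nu : ambient R n) : Prop :=
  dot nu nu = 1 /\ forall i : 'I_n, dot (partial i g u) nu = 0.

Definition first_fundamental_form : 'M[R]_n :=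
  \matrix_(i, j) dot (partial i g u) (partial j g u).

Definition second_fundamental_form (nu : ambient R n) : 'M[R]_n :=
  \matrix_(i, j) dot (partial i (partial j g) u) nu.

Definition mean_curvature (nu : ambient R n) : R :=
  \tr (invmx first_fundamental_form *m second_fundamental_form nu).

End LocalGeometry.

Definition minimal (R : realType) (n : nat) (M : manifold R n)
    (F : M -> ambient R n) : Prop :=
  forall p g u nu, local_param F p g u -> unit_normal g u nu ->
    mean_curvature g u nu = 0.

Definition support_hypersurface (R : realType) (n : nat) (omega : R -> R) :
    set (ambient R n) :=
  [set p | enorm p.1 = omega p.2 /\ p.2 != 0].

(* The normalized gradient of (x, z) |-> |x| - omega z, which points out of
   the region |x| < omega z. *)
Definition support_normal (R : realType) (n : nat) (omega : R -> R)
    (p : ambient R n) : ambient R n :=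
  (Num.sqrt (1 + derive1 omega p.2 ^+ 2))^-1 *:
    ((enorm p.1)^-1 *: p.1, - derive1 omega p.2).

Definition free_boundary (R : realType) (n : nat) (omega : R -> R)
    (M : manifold R n) (F : M -> ambient R n) : Prop :=
  forall p, mboundary p ->
    support_hypersurface omega (F p) /\
    forall g u nu, local_param F p g u -> unit_normal g u nu ->
      dot nu (support_normal omega (F p)) = 0.

Definition cone_profile (R : realType) (c : R) : R -> R := fun z => c * `|z|.

(* Main.v *)
Require Import Defs.
From mathcomp Require Import all_boot all_order all_algebra.
From mathcomp Require Import all_classical all_reals all_analysis.
From mathcomp Require Import ring lra.
Import Order.TTheory GRing.Theory Num.Theory.
Import numFieldNormedType.Exports.
Local Open Scope classical_set_scope.
Local Open Scope ring_scope.

(** Nonexistence follows from the maximum principle applied to the squared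
    distance to the vertex of the cone. The image of the hypersurface is compact,
    so |F|^2 has a maximum at some point p. Let g be a local parametrization at p
    and I the matrix of the products <d_i g, d_j g>.

    At p the gradient of |g|^2 vanishes, that is, the position vector g is
    normal to the hypersurface. For an interior point this is the first order
    condition. For a boundary point that condition only covers the directions
    d_i g tangent to the boundary. On the cone |F|^2 is a constant multiple of
    z^2, so that these d_i g are also horizontal; being orthogonal to g and
    horizontal, they are orthogonal to nu_Sigma.
    The free boundary condition makes nu_Sigma tangent to the hypersurface
    (comb_of_orthogonal), so nu_Sigma spans the remaining direction; and nu_Sigma
    is orthogonal to g because the cone is invariant under dilations
    (support_normal_orth). This is the proof of no_farthest_point.

    Since the gradient vanishes, the Hessian of |g|^2 is nonpositive, at a boundary
    point too: a direction or its opposite points into the half-space, and a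
    quadratic form is even (quad_form_le0_of_ray). No boundary point lemma of
    Hopf type is needed. Half of the Hessian has the matrix
    <d_i g, d_j g> + <d_i d_j g, g>. Its trace against the inverse of I is n plus
    the mean curvature in the normal direction g, which is zero; but this trace is
    nonpositive because the inverse of I is a Gram matrix (mxtrace_inv_gram_le0).
    Hence n <= 0, a contradiction. *)

Set Implicit Arguments.
Unset Strict Implicit.
Unset Printing Implicit Defensive.

(** * Maxima along rays *)

Section Rays.
Context {R : realType} {V : normedModType R}.
Implicit Types (h dh : V -> R) (u v : V).

Lemma cvg_ray u v : (t *: v + u) @[t --> (0 : R)^'+] --> u.
Proof.
rewrite -[X in _ --> X]add0r -[X in X + _](scale0r v).
apply: cvgD; last exact: cvg_cst.
apply: cvgZ; last exact: cvg_cst.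
exact: cvg_at_right_filter cvg_id.
Qed.

Lemma ray_near {P : set V} {u} v :
  (\forall y \near u, P y) -> \forall t \near (0 : R)^'+, P (t *: v + u).
Proof. by move=> Pu; exact: cvg_ray Pu. Qed.

Lemma is_derive_quotient_ray h u v (a : R) : is_derive u v h a ->
  (t^-1 * (h (t *: v + u) - h u)) @[t --> (0 : R)^'+] --> a.
Proof.
move=> [dh <-]; apply: cvg_trans; last exact: dh.
apply: cvg_app.
by move=> A [e e0 eA]; exists e => // t te /gt_eqF/negbT; exact: eA.
Qed.

Lemma first_order_ray h u v (a : R) : is_derive u v h a ->
  (\forall t \near (0 : R)^'+, h (t *: v + u) <= h u) -> a <= 0.
Proof.
move=> /is_derive_quotient_ray quot hu; apply: (cvgr_to_le quot); near=> t.
have t0 : 0 < t by [].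
rewrite pmulr_rle0 ?invr_gt0 // subr_le0.
by near: t.
Unshelve. all: by end_near. Qed.

Lemma is_derive_line h u v (s a : R) : is_derive (s *: v + u) v h a ->
  is_derive s 1 (fun t : R => h (t *: v + u)) a.
Proof.
have E : (fun t : R => t^-1 *: ((h \o shift (s *: v + u)) (t *: v) - h (s *: v + u)))
    = (fun t : R => t^-1 *: (((fun r : R => h (r *: v + u)) \o shift s) (t *: 1)
        - h (s *: v + u))).
  by apply/funext => t /=; rewrite [t *: 1]mulr1 scalerDl addrA.
by move=> [dh <-]; split; rewrite /derivable /derive -E.
Qed.

(** Second order necessary condition for a one-sided maximum: the function dh
    only needs to be the derivative of h in the single direction v. *)
Lemma second_order_ray h dh u v (a : R) :
  (\forall y \near u, is_derive y v h (dh y)) -> is_derive u v dh a ->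
  dh u = 0 -> (\forall t \near (0 : R)^'+, h (t *: v + u) <= h u) -> a <= 0.
Proof.
move=> hd dhd dhu hmax; rewrite leNgt; apply/negP => a0.
(* If a > 0, then dh is positive along a short ray, and the mean value theorem
   makes h increase along it. *)
have q0 := cvgr_gt _ (is_derive_quotient_ray dhd) _ a0.
have : \forall t \near (0 : R)^'+, [/\ is_derive (t *: v + u) v h (dh (t *: v + u)),
   0 < dh (t *: v + u) & h (t *: v + u) <= h u].
  near=> t; split.
  - by near: t; exact: (ray_near v hd).
  - have t0 : 0 < t by [].
    have : 0 < t^-1 * (dh (t *: v + u) - dh u) by near: t; exact: q0.
    by rewrite dhu subr0 pmulr_rgt0 ?invr_gt0.
  - by near: t.
move=> [e /= e0 eP].
have e20 : 0 < e / 2 by rewrite divr_gt0.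
have P t : 0 < t -> t <= e / 2 -> [/\ is_derive (t *: v + u) v h (dh (t *: v + u)),
   0 < dh (t *: v + u) & h (t *: v + u) <= h u].
  move=> t0 te; apply: eP => //=.
  by rewrite sub0r normrN gtr0_norm //; lra.
have D t : 0 <= t -> t <= e / 2 ->
    is_derive t 1 (fun t : R => h (t *: v + u)) (dh (t *: v + u)).
  rewrite le_eqVlt => /orP[/eqP <- _|t0 te]; apply: is_derive_line.
    rewrite scale0r add0r; exact: nbhs_singleton hd.
  by have [] := P t t0 te.
have [||t] :=
  @MVT R (fun t => h (t *: v + u)) (fun t => dh (t *: v + u)) 0 (e / 2) e20.
- move=> t; rewrite in_itv/= => /andP[t0 te]; apply: D; exact: ltW.
- apply: derivable_within_continuous => t; rewrite in_itv/= => /andP[t0 te].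
  by have [] := D _ t0 te.
rewrite in_itv/= => /andP[t0 te].
have [_ dt _] := P t t0 (ltW te).
have [_ _ he] := P _ e20 (lexx _).
rewrite scale0r add0r subr0 => E.
by have := mulr_gt0 dt e20; rewrite -E; lra.
Unshelve. all: by end_near. Qed.

End Rays.

(** * The Euclidean product of the ambient space *)

Section Dot.
Context {R : realType} {n : nat}.
Implicit Types (p q w : ambient R n) (a : R).

Lemma dotC p q : dot p q = dot q p.
Proof.
rewrite /dot mulrC; congr (_ + _).
by apply: eq_bigr => i _; rewrite mulrC.
Qed.

Lemma dotDl p q w : dot (p + q) w = dot p w + dot q w.
Proof.
rewrite /dot /dotv /= mulrDl addrACA; congr (_ + _).
by rewrite -big_split; apply: eq_bigr => i _; rewrite /= mxE mulrDl.
Qed.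

Lemma dotZl a p w : dot (a *: p) w = a * dot p w.
Proof.
rewrite /dot /dotv /= mulrDr mulrA; congr (_ + _).
by rewrite mulr_sumr; apply: eq_bigr => i _; rewrite /= mxE mulrA.
Qed.

Lemma dot0l w : dot 0 w = 0.
Proof. by rewrite -(scale0r 0) dotZl mul0r. Qed.

Lemma dotNl p w : dot (- p) w = - dot p w.
Proof. by rewrite -scaleN1r dotZl mulN1r. Qed.

Lemma dotZr a p w : dot w (a *: p) = a * dot w p.
Proof. by rewrite dotC dotZl dotC. Qed.

Lemma dot_suml I (r : seq I) (P : pred I) (f : I -> ambient R n) w :
  dot (\sum_(i <- r | P i) f i) w = \sum_(i <- r | P i) dot (f i) w.
Proof.
by elim/big_rec2: _ => [|i x y _ <-]; rewrite ?dot0l ?dotDl.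
Qed.

Lemma dot_sum_single m (e : 'I_m -> ambient R n) (a : 'I_m -> R) i w :
  (forall j, j != i -> dot (e j) w = 0) ->
  dot (\sum_j a j *: e j) w = a i * dot (e i) w.
Proof.
move=> ew; rewrite dot_suml (bigD1 i) //= dotZl.
by rewrite big1 ?addr0 // => j /ew ejw; rewrite dotZl ejw mulr0.
Qed.

Lemma dotv_ge0 (x : 'rV[R]_n) : 0 <= dotv x x.
Proof. by apply: sumr_ge0 => i _; rewrite -expr2 sqr_ge0. Qed.

Lemma dot_ge0 p : 0 <= dot p p.
Proof. by rewrite addr_ge0 ?dotv_ge0 // -expr2 sqr_ge0. Qed.

Lemma dot_eq0 p : dot p p = 0 -> p = 0.
Proof.
move/eqP; rewrite paddr_eq0 ?dotv_ge0 -?expr2 ?sqr_ge0 //.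
rewrite psumr_eq0 => [/andP[/allP p1 p2]|i _]; last by rewrite -expr2 sqr_ge0.
case: p p1 p2 => x z /= x0; rewrite sqrf_eq0 => /eqP ->.
congr pair; apply/rowP => i.
by have := x0 i (mem_index_enum i); rewrite -expr2 sqrf_eq0 mxE => /eqP.
Qed.

Lemma continuous_coord1 (i : 'I_n) : continuous (fun p : ambient R n => p.1 0 i).
Proof.
move=> p; apply: (@continuous_comp _ _ _ fst (fun x : 'rV[R]_n => x 0 i)).
  exact: cvg_fst.
exact: coord_continuous.
Qed.

Lemma continuous_dot_self : continuous (fun p => dot p p).
Proof.
have cs : continuous (fun p : ambient R n => dotv p.1 p.1).
  rewrite /dotv -(fct_sumE _ _ (fun i (p : ambient R n) => p.1 0 i * p.1 0 i)).
  apply: (big_ind (fun f : ambient R n -> R => continuous f)) => [|f g cf cg|i _] p.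
  - exact: cvg_cst.
  - by apply: cvgD; [exact: cf|exact: cg].
  - by apply: cvgM; exact: continuous_coord1.
move=> p; apply: cvgD; first exact: cs.
by apply: cvgM; exact: cvg_snd.
Qed.

End Dot.

Section DotCalculus.
Context {R : realType} {n : nat} {V : normedModType R}.
Implicit Types (f g : V -> ambient R n) (u v : V).

Lemma is_derive_continuous_linear (W W' : normedModType R)
    (L : W -> W') (f : V -> W) u v df :
  linear L -> continuous L -> is_derive u v f df -> is_derive u v (L \o f) (L df).
Proof.
move=> lL cL [fd <-].
have L0 : L 0 = 0 by have := lL (-1) 0 0; rewrite !scaleN1r !addNr.
have LZB a x y : L (a *: (x - y)) = a *: (L x - L y).
  have := lL a (x - y) 0; rewrite !addr0 L0 addr0 => ->.
  by have := lL (-1) y x; rewrite !scaleN1r !(addrC (- _)) => ->.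
suff c : (fun t => t^-1 *: (((L \o f) \o shift u) (t *: v) - (L \o f) u)) @ 0^'
    --> L ('D_v f u).
  by split; [apply/cvg_ex; eexists; exact: c | exact: cvg_lim c].
have -> : (fun t => t^-1 *: (((L \o f) \o shift u) (t *: v) - (L \o f) u)) =
    L \o (fun t => t^-1 *: ((f \o shift u) (t *: v) - f u)).
  by apply/funext => t; rewrite /= LZB.
exact: continuous_cvg (cL _) fd.
Qed.

Lemma is_derive_snd f u v df : is_derive u v f df ->
  is_derive u v (fun y => (f y).2) df.2.
Proof.
move=> fd.
have := @is_derive_continuous_linear _ _ (fun p : ambient R n => p.2) f u v df.
apply => //.
by move=> p; exact: cvg_snd.
Qed.

Lemma is_derive_coord f u v df (i : 'I_n) : is_derive u v f df ->
  is_derive u v (fun y => (f y).1 0 i) (df.1 0 i).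
Proof.
move=> fd.
apply: (is_derive_continuous_linear (L:=fun p : ambient R n => p.1 0 i)) => //.
  by move=> a p q; rewrite /= !mxE.
exact: continuous_coord1.
Qed.

Lemma is_derive_dot f g u v df dg :
  is_derive u v f df -> is_derive u v g dg ->
  is_derive u v (fun y => dot (f y) (g y)) (dot df (g u) + dot (f u) dg).
Proof.
move=> fd gd.
have -> : (fun y => dot (f y) (g y)) =
    \sum_(i < n) ((fun y => (f y).1 0 i) * (fun y => (g y).1 0 i)) +
      (fun y => (f y).2) * (fun y => (g y).2).
  by apply/funext => y; rewrite fctE fct_sumE.
have := is_derive_coord _ fd; have := is_derive_coord _ gd => cg cf.
have sf := is_derive_snd fd; have sg := is_derive_snd gd.
apply: is_derive_eq.
rewrite /dot /dotv addrACA -big_split /=; congr (_ + _).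
  by apply: eq_bigr => i _ /=; rewrite addrC; congr (_ + _); rewrite [LHS]mulrC.
by rewrite addrC; congr (_ + _); rewrite [LHS]mulrC.
Qed.

End DotCalculus.

(** * Gram matrices *)

Section Matrices.
Context {R : realType}.

Lemma quad_formE n (S : 'M[R]_n) (v : 'rV[R]_n) :
  (v *m S *m v^T) 0 0 = \sum_i \sum_j v 0 i * v 0 j * S i j.
Proof.
rewrite mxE exchange_big /=; apply: eq_bigr => j _.
rewrite !mxE mulr_suml; apply: eq_bigr => i _.
by rewrite mulrAC.
Qed.

(** The trace of a product of two semidefinite matrices of opposite signs; S need
    not be symmetric. *)
Lemma mxtrace_gram_le0 m k (B : 'M[R]_(m, k)) (S : 'M[R]_m) :
  (forall v : 'rV_m, (v *m S *m v^T) 0 0 <= 0) -> \tr (B *m B^T *m S) <= 0.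
Proof.
move=> S0; rewrite -mulmxA mxtrace_mulC; apply: sumr_le0 => i _.
have -> : (B^T *m S *m B) i i = (row i B^T *m S *m (row i B^T)^T) 0 0.
  rewrite -row_mul tr_row trmxK mxE [RHS]mxE.
  by apply: eq_bigr => j _; rewrite [in RHS]mxE; congr (_ * _); rewrite mxE.
exact: S0.
Qed.

End Matrices.

Section Gram.
Context {R : realType} {m n : nat}.
Variable e : 'I_m -> ambient R n.
Implicit Types (w : ambient R n) (a : 'rV[R]_m).

(** The matrix of the Euclidean products of the family e. *)
Definition gram : 'M[R]_m := \matrix_(i, j) dot (e i) (e j).

(** w is orthogonal to the span of the family e. *)
Definition normal_to w := forall i, dot (e i) w = 0.

Lemma gram_sym : gram^T = gram.
Proof. by apply/matrixP => i j; rewrite !mxE dotC. Qed.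

Lemma dot_comb a j :
  dot (\sum_i a 0 i *: e i) (e j) = (a *m gram) 0 j.
Proof.
by rewrite dot_suml mxE; apply: eq_bigr => i _; rewrite dotZl mxE.
Qed.

Lemma gram_quadratic a : (a *m gram *m a^T) 0 0 =
  dot (\sum_i a 0 i *: e i) (\sum_i a 0 i *: e i).
Proof.
set s := \sum_i _; rewrite mxE {1}/s dot_suml; apply: eq_bigr => j _.
by rewrite dotZl dotC dot_comb mulrC [a^T _ _]mxE.
Qed.

(** The rows of B are the vectors of the family, with z as last coordinate. *)
Lemma gram_factor : exists B : 'M[R]_(m, n + 1), gram = B *m B^T.
Proof.
pose B := \matrix_i row_mx (e i).1 (e i).2%:M.
have Bx i k : B i (lshift 1 k) = (e i).1 0 k by rewrite mxE row_mxEl.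
have Bz i : B i (rshift n 0) = (e i).2 by rewrite mxE row_mxEr mxE eqxx mulr1n.
exists B; apply/matrixP => i j; rewrite mxE [RHS]mxE big_split_ord /= big_ord1.
congr (_ + _); last by rewrite [_^T _ _]mxE !Bz.
by apply: eq_bigr => k _; rewrite [_^T _ _]mxE !Bx.
Qed.

Lemma mxtrace_inv_gram_le0 (S : 'M[R]_m) : gram \in unitmx ->
  (forall v : 'rV_m, (v *m S *m v^T) 0 0 <= 0) -> \tr (invmx gram *m S) <= 0.
Proof.
move=> Gu S0; have [B GB] := gram_factor; set P := invmx gram.
(* The inverse of a Gram matrix G is the Gram matrix G^-1 G G^-1. *)
have -> : P = (P *m B) *m (P *m B)^T.
  rewrite trmx_mul mulmxA -[P *m B *m _]mulmxA -GB mulVmx // mul1mx.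
  by rewrite /P trmx_inv gram_sym.
exact: mxtrace_gram_le0.
Qed.

(** Double orthogonality: a vector orthogonal to every vector normal to e lies
    in the span of e. *)
Lemma comb_of_orthogonal w : gram \in unitmx ->
  (forall r, normal_to r -> r != 0 -> dot r w = 0) ->
  exists a : 'rV[R]_m, w = \sum_i a 0 i *: e i.
Proof.
move=> Gu wt; pose b := \row_j dot w (e j).
(* The combination is the orthogonal projection of w onto the span. *)
exists (b *m invmx gram); set s := \sum_i _; apply: subr0_eq.
have rn : normal_to (w - s).
  by move=> j; rewrite dotC dotDl dotNl dot_comb mulmxKV // mxE subrr.
apply/eqP/negP => /negP r0.
suff /dot_eq0 E : dot (w - s) (w - s) = 0 by rewrite E eqxx in r0.
rewrite {1}dotDl dotNl dotC wt // sub0r dot_suml big1 ?oppr0 // => i _.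
by rewrite dotZl rn mulr0.
Qed.

End Gram.

(** * Fundamental forms *)

Section LocalSurface.
Context {R : realType} {n : nat}.
Implicit Types (g : 'rV[R]_n -> ambient R n) (u v : 'rV[R]_n) (w : ambient R n).

Lemma derive_partial g y v : differentiable g y ->
  'D_v g y = \sum_i v 0 i *: partial i g y.
Proof.
move=> gd; rewrite deriveE // [in LHS](row_sum_delta v) linear_sum.
by apply: eq_bigr => i _; rewrite linearZ /partial deriveE.
Qed.

Lemma smooth_near_differentiable g u : smooth_near g u -> differentiable g u.
Proof. by move=> /nbhs_singleton /(_ [::]). Qed.

Lemma smooth_near_is_derive g u : smooth_near g u ->
  \forall y \near u, forall v, is_derive y v g ('D_v g y).
Proof.
apply: filterS => y /(_ [::]) /= gd v.
exact: derivableP (diff_derivable _).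
Qed.

Lemma smooth_near_is_derive2 g u v v' : smooth_near g u ->
  is_derive u v' ('D_v g) ('D_v' ('D_v g) u).
Proof.
by move=> /nbhs_singleton /(_ [:: v]) /= gd; apply: derivableP; exact: diff_derivable.
Qed.

Lemma derive2_partial g u v : smooth_near g u ->
  'D_v ('D_v g) u = \sum_i \sum_j (v 0 i * v 0 j) *: partial i (partial j g) u.
Proof.
move=> gs.
have -> : 'D_v ('D_v g) u = 'D_v (\sum_j v 0 j *: partial j g) u.
  apply: near_eq_derive; apply: filterS gs => y /(_ [::]) /= gd.
  by rewrite derive_partial // fct_sumE.
rewrite derive_partial; last first.
  apply: differentiable_sum => j; apply: differentiableZ.
  by move: gs => /nbhs_singleton /(_ [:: delta_mx 0 j]).
apply: eq_bigr => i _.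
have dij j := smooth_near_is_derive2 (delta_mx 0 j) (delta_mx 0 i) gs.
have -> : partial i (\sum_j v 0 j *: partial j g) u =
   \sum_j v 0 j *: partial i (partial j g) u.
  by rewrite /partial; exact: derive_val.
by rewrite scaler_sumr; apply: eq_bigr => j _; rewrite scalerA.
Qed.

(** Here w is arbitrary, in particular it need be neither unit nor normal. *)
Lemma sff_quadratic g u v w : smooth_near g u ->
  (v *m second_fundamental_form g u w *m v^T) 0 0 = dot ('D_v ('D_v g) u) w.
Proof.
move=> gs; rewrite quad_formE derive2_partial // dot_suml; apply: eq_bigr => i _.
by rewrite dot_suml; apply: eq_bigr => j _; rewrite dotZl mxE.
Qed.

Lemma fffE g u : first_fundamental_form g u = gram (fun i => partial i g u).
Proof. by []. Qed.

Lemma fff_unit g u : differentiable g u -> injective ('d g u) ->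
  first_fundamental_form g u \in unitmx.
Proof.
move=> gd ginj; rewrite -row_free_unit; apply: inj_row_free => v vI.
apply: ginj; rewrite linear0 -deriveE // derive_partial //; apply: dot_eq0.
by rewrite -gram_quadratic -fffE vI mul0mx mxE.
Qed.

(** w is normal, not necessarily of unit length, to the hypersurface g at u. *)
Definition normal_vector g u := normal_to (fun i => partial i g u).

Lemma unit_normal_normalize g u w : normal_vector g u w -> w != 0 ->
  unit_normal g u ((Num.sqrt (dot w w))^-1 *: w).
Proof.
move=> wn w0; split=> [|i]; last by rewrite dotZr wn mulr0.
have ww : dot w w != 0 by apply: contra_neq w0; exact: dot_eq0.
rewrite dotZl dotZr mulrA -expr2 exprVn sqr_sqrtr ?dot_ge0 //.
by rewrite mulVf.
Qed.

(** Vanishing of the mean curvature extends to normals of any length, zero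
    included. *)
Lemma normal_mean_curvature0 g u w :
  (forall nu, unit_normal g u nu -> mean_curvature g u nu = 0) ->
  normal_vector g u w -> mean_curvature g u w = 0.
Proof.
move=> H0 wn.
have mcZ a : mean_curvature g u (a *: w) = a * mean_curvature g u w.
  rewrite /mean_curvature -mxtraceZ scalemxAr; congr (\tr (_ *m _)).
  by apply/matrixP => i j; rewrite !mxE dotZr.
have [->|w0] := eqVneq w 0; first by rewrite -(scale0r w) mcZ mul0r.
have := H0 _ (unit_normal_normalize wn w0).
move/eqP; rewrite mcZ mulf_eq0 => /orP[|/eqP //].
rewrite invr_eq0 sqrtr_eq0 => ww.
move: w0; rewrite (@dot_eq0 _ _ w) ?eqxx //.
by apply/eqP; rewrite eq_le ww dot_ge0.
Qed.

Lemma tangent_of_normals g u w :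
  first_fundamental_form g u \in unitmx ->
  (forall nu, unit_normal g u nu -> dot nu w = 0) ->
  exists a : 'rV[R]_n, w = \sum_i a 0 i *: partial i g u.
Proof.
rewrite fffE => Iu wt; apply: comb_of_orthogonal Iu _ => r rn r0.
have := wt _ (unit_normal_normalize rn r0); rewrite dotZl.
move=> /eqP; rewrite mulf_eq0 invr_eq0 sqrtr_eq0 => /orP[rr|/eqP //].
move: r0; rewrite (@dot_eq0 _ _ r) ?eqxx //.
by apply/eqP; rewrite eq_le rr dot_ge0.
Qed.

End LocalSurface.

(** * The squared distance to the origin along a hypersurface *)

Section SquaredDistance.
Context {R : realType} {n : nat}.
Implicit Types (g : 'rV[R]_n -> ambient R n) (u v : 'rV[R]_n).

(** The ray issuing from u in the direction v starts with values of h at most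
    h u; at a boundary point only the rays entering the half-space are at hand. *)
Definition below_along_ray (h : 'rV[R]_n -> R) u v :=
  \forall t \near (0 : R)^'+, h (t *: v + u) <= h u.

Lemma deriveNdir g u v : differentiable g u -> 'D_(- v) g u = - 'D_v g u.
Proof. by move=> gd; rewrite !deriveE // linearN. Qed.

(** The matrix is half of the Hessian of |g|^2; since g u is normal, the gradient
    of |g|^2 vanishes at u. *)
Lemma quad_form_le0_of_ray g u v : smooth_near g u ->
  normal_vector g u (g u) -> below_along_ray (fun y => dot (g y) (g y)) u v ->
  (v *m (first_fundamental_form g u + second_fundamental_form g u (g u)) *m v^T)
    0 0 <= 0.
Proof.
move=> gs gn; have gd := smooth_near_differentiable gs.
have hd : \forall y \near u, is_derive y v (fun y => dot (g y) (g y))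
    (2 * dot ('D_v g y) (g y)).
  apply: filterS (smooth_near_is_derive gs) => y /(_ v) gy.
  apply: is_derive_eq (is_derive_dot gy gy) _.
  by rewrite [X in _ + X]dotC mulr_natl mulr2n.
have gu : is_derive u v g ('D_v g u) by apply: derivableP; exact: diff_derivable.
have hdd : is_derive u v (fun y => 2 * dot ('D_v g y) (g y))
    (2 * (dot ('D_v ('D_v g) u) (g u) + dot ('D_v g u) ('D_v g u))).
  have := is_derive_dot (smooth_near_is_derive2 v v gs) gu.
  exact: is_deriveZ.
move=> /(second_order_ray hd hdd) h0.
rewrite mulmxDr mulmxDl mxE fffE gram_quadratic -derive_partial //.
rewrite sff_quadratic // addrC.
rewrite -(pmulr_rle0 (x := 2)) //; apply: h0.
rewrite derive_partial // dot_suml big1 ?mulr0 // => i _.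
by rewrite dotZl gn mulr0.
Qed.

(** Nonpositivity of the Hessian of |g|^2 contradicts minimality where the
    position vector is normal; since a quadratic form is even, one of the
    directions v and - v suffices. *)
Lemma no_ray_maximum_at_normal_position g u : (0 < n)%N -> smooth_near g u ->
  injective ('d g u) ->
  (forall nu, unit_normal g u nu -> mean_curvature g u nu = 0) ->
  normal_vector g u (g u) ->
  ~ (forall v, below_along_ray (fun y => dot (g y) (g y)) u v \/
       below_along_ray (fun y => dot (g y) (g y)) u (- v)).
Proof.
move=> n0 gs ginj H0 gn hmax.
have Iu := fff_unit (smooth_near_differentiable gs) ginj.
set S := first_fundamental_form g u + second_fundamental_form g u (g u).
have S0 (v : 'rV_n) : (v *m S *m v^T) 0 0 <= 0.
  have [/quad_form_le0_of_ray|/quad_form_le0_of_ray] := hmax v; first exact.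
  by rewrite linearN /= mulNmx mulmxN mulNmx opprK; apply.
(* The trace is n plus the mean curvature in the direction g u. *)
have := mxtrace_inv_gram_le0 Iu S0; rewrite -fffE.
rewrite mulmxDr mxtraceD mulVmx // mxtrace1.
have := normal_mean_curvature0 H0 gn; rewrite /mean_curvature => ->.
by rewrite addr0 lern0 -leqn0 leqNgt n0.
Qed.

Lemma critical_along_line g u v : smooth_near g u ->
  below_along_ray (fun y => dot (g y) (g y)) u v ->
  below_along_ray (fun y => dot (g y) (g y)) u (- v) ->
  dot ('D_v g u) (g u) = 0.
Proof.
move=> gs; have gd := smooth_near_differentiable gs.
have gu w : is_derive u w g ('D_w g u) by apply: derivableP; exact: diff_derivable.
move=> /(first_order_ray (is_derive_dot (gu _) (gu _))) h1.
move=> /(first_order_ray (is_derive_dot (gu _) (gu _))).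
rewrite deriveNdir // [X in _ + X]dotC dotNl -opprD oppr_le0 => h2.
move: h1; rewrite [X in _ + X]dotC => h1; lra.
Qed.

Lemma height_critical_along_line g u v : smooth_near g u -> (g u).2 != 0 ->
  below_along_ray (fun y => (g y).2 ^+ 2) u v ->
  below_along_ray (fun y => (g y).2 ^+ 2) u (- v) ->
  ('D_v g u).2 = 0.
Proof.
move=> gs z0; have gd := smooth_near_differentiable gs.
have zd w : is_derive u w (fun y => (g y).2 ^+ 2) (2 * (g u).2 * ('D_w g u).2).
  have gu : is_derive u w g ('D_w g u) by apply: derivableP; exact: diff_derivable.
  have := is_deriveX 2 (is_derive_snd gu).
  by rewrite exprfctE expr1.
move=> /(first_order_ray (zd _)) h1 /(first_order_ray (zd _)).
rewrite deriveNdir //= mulrN oppr_le0 => h2.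
have : 2 * (g u).2 * ('D_v g u).2 = 0 by apply/eqP; rewrite eq_le h1 h2.
by move/eqP; rewrite !mulf_eq0 pnatr_eq0 (negbTE z0) => /eqP.
Qed.

End SquaredDistance.

(** * The cone and its normal *)

Section Cone.
Context {R : realType} {n : nat}.
Variables (c : R).
Hypothesis c_gt0 : 0 < c.
Implicit Types (p w : ambient R n) (z : R).

Lemma derive1_cone_profile z : z != 0 -> derive1 (cone_profile c) z = c * Num.sg z.
Proof.
move=> z0.
have E : \forall y \near z, cone_profile c y = (c * Num.sg z) * y.
  rewrite /cone_profile; move: z0; rewrite neq_lt => /orP[zn|zp].
    rewrite ltr0_sg //; near=> y.
    by rewrite ltr0_norm ?mulrN1 ?mulNr ?mulrN //; near: y; exact: lt_nbhsl.
  rewrite gtr0_sg //; near=> y.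
  by rewrite mulr1 gtr0_norm //; near: y; exact: lt_nbhsr.
rewrite derive1E (near_eq_derive _ E).
have /@derive_val := is_deriveZ (c * Num.sg z) (is_derive_id z 1).
by rewrite [X in _ = X -> _]mulr1.
Unshelve. all: by end_near. Qed.

Lemma enorm_sqr (x : 'rV[R]_n) : enorm x ^+ 2 = dotv x x.
Proof. by rewrite sqr_sqrtr ?dotv_ge0. Qed.

Lemma dot_cone p : support_hypersurface (cone_profile c) p ->
  dot p p = (1 + c ^+ 2) * p.2 ^+ 2.
Proof.
move=> [xz _]; rewrite /dot -enorm_sqr xz /cone_profile exprMn real_normK ?num_real //.
ring.
Qed.

Lemma support_normal_cone p : support_hypersurface (cone_profile c) p ->
  exists2 k : R, k != 0 & support_normal (cone_profile c) p =
    k *: ((enorm p.1)^-1 *: p.1, - (c * Num.sg p.2)).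
Proof.
move=> [_ z0]; exists (Num.sqrt (1 + derive1 (cone_profile c) p.2 ^+ 2))^-1.
  by rewrite invr_eq0 sqrtr_eq0 -ltNge ltr_pwDl ?sqr_ge0.
by rewrite /support_normal derive1_cone_profile.
Qed.

(** The support function of a cone with vertex at the origin vanishes. *)
Lemma support_normal_orth p : support_hypersurface (cone_profile c) p ->
  dot (support_normal (cone_profile c) p) p = 0.
Proof.
move=> pS; have [k _ ->] := support_normal_cone pS; have [xz z0] := pS.
have x0 : enorm p.1 != 0 by rewrite xz mulf_neq0 ?normr_eq0 // gt_eqF.
rewrite dotZl [dot _ _](_ : _ =
  (enorm p.1)^-1 * dotv p.1 p.1 - c * (Num.sg p.2 * p.2)); last first.
  rewrite /dot /= mulNr -mulrA; congr (_ - _).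
  by rewrite /dotv mulr_sumr; apply: eq_bigr => i _; rewrite mxE mulrA.
by rewrite -enorm_sqr expr2 mulKf // -normrEsg xz subrr mulr0.
Qed.

Lemma support_normal_neq0 p : support_hypersurface (cone_profile c) p ->
  support_normal (cone_profile c) p != 0.
Proof.
move=> pS; have [k k0 ->] := support_normal_cone pS.
apply/eqP => /(congr1 snd) /= /eqP.
have [_ z0] := pS.
by rewrite mulf_eq0 (negbTE k0) oppr_eq0 mulf_eq0 sgr_eq0 (negbTE z0) gt_eqF.
Qed.

Lemma support_normal_horizontal p w : support_hypersurface (cone_profile c) p ->
  w.2 = 0 -> dot w p = 0 -> dot w (support_normal (cone_profile c) p) = 0.
Proof.
move=> pS w2 wp; have [k _ ->] := support_normal_cone pS.
set r := _^-1; suff E : dot w (r *: p.1, - (c * Num.sg p.2)) = r * dot w p.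
  by rewrite dotZr E wp !mulr0.
rewrite /dot w2 !mul0r !addr0 /dotv mulr_sumr; apply: eq_bigr => i _.
by rewrite mxE mulrCA.
Qed.

End Cone.

(** * Farthest points *)

Lemma bounded_closed_compact_ambient (R : realType) (n : nat)
  (A : set (ambient R n)) : bounded_set A -> closed A -> compact A.
Proof.
move=> [N [_ bN]] Ac; have := bN (N + 1) (ltr_pwDr ltr01 (lexx N)).
move: (N + 1) => b bA {N bN}.
have cX : compact [set x : 'rV[R]_n | `|x| <= b].
  apply: bounded_closed_compact.
    by exists b; split=> [|e be x /= xb]; [exact: num_real|exact: le_trans xb (ltW be)].
  by apply: closed_comp (@closed_le R b) => x _; exact: norm_continuous.
have cZ : compact [set z : R | `|z| <= b].
  have -> : [set z : R | `|z| <= b] = `[- b, b]%classic.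
    by apply/seteqP; split=> z; rewrite /= in_itv /= ler_norml.
  exact: segment_compact.
apply: subclosed_compact Ac (compact_setX cX cZ) _ => p /bA.
by rewrite /= prod_normE ge_max => /andP[].
Qed.

Section FirstCoordinate.
Context {R : realType} {n : nat}.
Variable n_gt0 : (0 < n)%N.
Implicit Types (u v : 'rV[R]_n).

(** The index of the coordinate that defines the half-space. *)
Definition ord_first : 'I_n := Ordinal n_gt0.

Lemma half_spaceE u : half_space u <-> 0 <= u 0 ord_first.
Proof.
split=> [|u0 i i0]; first exact.
by rewrite (_ : i = ord_first) //; exact: val_inj.
Qed.

Lemma half_space_boundaryE u : half_space_boundary u <-> u 0 ord_first = 0.
Proof.
split=> [[i i0]|]; last by exists ord_first.
by rewrite (_ : i = ord_first) //; exact: val_inj.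
Qed.

Lemma half_space_ray u v : half_space u -> 0 <= v 0 ord_first ->
  \forall t \near (0 : R)^'+, half_space (t *: v + u).
Proof.
move=> /half_spaceE u0 v0; near=> t; apply/half_spaceE.
have t0 : 0 < t by [].
by rewrite !mxE addr_ge0 // mulr_ge0 // ltW.
Unshelve. all: by end_near. Qed.

Lemma half_space_interior u : half_space u -> ~ half_space_boundary u ->
  \forall y \near u, half_space y.
Proof.
move=> /half_spaceE u0 /half_space_boundaryE ub.
have {u0 ub}u0 : 0 < u 0 ord_first by rewrite lt_neqAle u0 andbT eq_sym; apply/eqP.
have pos : \forall y \near u, 0 < (y : 'rV[R]_n) 0 ord_first.
  exact: (@cvgr_gt R _ (nbhs u) _ (fun y : 'rV[R]_n => y 0 ord_first) _
    (@coord_continuous _ _ _ 0 ord_first u) _ u0).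
by apply: filterS pos => y y0; apply/half_spaceE; exact: ltW.
Qed.

End FirstCoordinate.

Section Main.
Context {R : realType} {n : nat}.
Variables (c : R) (M : manifold R n) (F : M -> ambient R n).
Hypotheses (n_gt0 : (0 < n)%N) (c_gt0 : 0 < c).
Hypotheses (F_imm : immersion F) (F_min : minimal F).
Hypothesis F_free : free_boundary (cone_profile c) F.

(** The maximum principle for the squared distance to the vertex. *)
Lemma no_farthest_point p : ~ (forall q, dot (F q) (F q) <= dot (F p) (F p)).
Proof.
move=> pmax; have [F_smooth F_inj] := F_imm.
have [phi phiA pphi] := atlas_cover p.
set u := cmap phi p.
have up : cimg phi u by exists p.
have [g [gs gF]] := F_smooth phi phiA u up.
have lp : local_param F p g u by exists phi.
have gd := smooth_near_differentiable gs.
have gu : g u = F p by rewrite (nbhs_singleton gF) //= cmapK.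
have [W Wo WE] := @cimg_open _ _ _ phi.
have uWh : (W `&` @half_space R n) u by rewrite -WE.
have gnear : \forall y \near u, half_space y ->
    cimg phi y /\ g y = F (cinv phi y).
  have Wu : \forall y \near u, W y by apply: open_nbhs_nbhs; split => //; exact: uWh.1.
  apply: filterS2 Wu gF => y Wy gy hy.
  have yphi : cimg phi y by rewrite /cimg WE.
  by split => //; exact: gy.
have ray v : (\forall t \near (0 : R)^'+, half_space (t *: v + u)) ->
    below_along_ray (fun y => dot (g y) (g y)) u v.
  move=> hv; rewrite /below_along_ray gu.
  by apply: filterS2 (ray_near v gnear) hv => t /[apply] -[_ ->].
have H0 nu : unit_normal g u nu -> mean_curvature g u nu = 0 by exact: F_min lp.
apply: (no_ray_maximum_at_normal_position n_gt0 gs (F_inj _ _ _ lp) H0) => [|v];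
  last first.
  have [v0|v0] := leP 0 (v 0 (ord_first n_gt0)).
    by left; apply: ray; exact: half_space_ray uWh.2 v0.
  right; apply: ray; apply: (half_space_ray (n_gt0 := n_gt0)); first exact: uWh.2.
  by rewrite mxE oppr_ge0 ltW.
(* It remains to see that the position vector is normal. At an interior point
   every line through u stays in the half-space. *)
have [ub|ui] := pselect (half_space_boundary u); last first.
  move=> i; have hu := half_space_interior n_gt0 uWh.2 ui.
  by apply: critical_along_line gs _ _; apply: ray; exact: ray_near.
have pb : mboundary p by exists phi.
have [pS wnu] := F_free pb.
(* The directions tangent to the boundary: |g|^2 is critical in both senses,
   and so is z^2, which is proportional to |g|^2 on the cone. *)
have edge i : i != ord_first n_gt0 -> dot (partial i g u) (g u) = 0 /\
    (partial i g u).2 = 0.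
  move=> i0.
  pose e s : R -> 'rV[R]_n := fun t => t *: (s *: delta_mx 0 i) + u.
  have line s : \forall t \near (0 : R)^'+, half_space_boundary (e s t).
    near=> t; apply/(half_space_boundaryE n_gt0).
    rewrite !mxE eqxx eq_sym (negbTE i0) !mulr0 add0r.
    exact/(half_space_boundaryE n_gt0).
  have hline s : \forall t \near (0 : R)^'+, half_space (e s t).
    apply: filterS (line s) => t /(half_space_boundaryE n_gt0) t0.
    by apply/(half_spaceE n_gt0); rewrite t0.
  have zline s : below_along_ray (fun y => (g y).2 ^+ 2) u (s *: delta_mx 0 i).
    rewrite /below_along_ray; near=> t; rewrite -/(e s t).
    have dt : dot (g (e s t)) (g (e s t)) <= dot (g u) (g u).
      by near: t; exact: (ray _ (hline s)).
    have bt : half_space_boundary (e s t) by near: t.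
    have [[q qphi qt] gq] : cimg phi (e s t) /\ g (e s t) = F (cinv phi (e s t)).
      have ht : half_space (e s t) by near: t.
      by move: ht; near: t; exact: (ray_near _ gnear).
    have qb : mboundary (cinv phi (e s t)).
      by rewrite -qt cmapK //; exists phi; split => //; rewrite qt.
    move: dt; rewrite gu (dot_cone pS) gq (dot_cone (F_free qb).1) ler_pM2l //.
    by rewrite ltr_pwDl // sqr_ge0.
  have z0 : (g u).2 != 0 by rewrite gu; exact: pS.2.
  have := hline 1; have := hline (-1); have := zline 1; have := zline (-1).
  rewrite /e scale1r scaleN1r => zN zP hN hP.
  by split; [apply: critical_along_line; [|exact: ray..] |
    apply: height_critical_along_line].
(* The transverse direction, by means of the normal w of the cone. *)
move=> i; have [->|/edge[] //] := eqVneq i (ord_first n_gt0).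
set w := support_normal (cone_profile c) (F p).
have Iu := fff_unit gd (F_inj _ _ _ lp).
have [a wa] : exists a : 'rV[R]_n, w = \sum_i a 0 i *: partial i g u.
  by apply: tangent_of_normals Iu _ => nu; exact: wnu lp.
have wdot x : (forall i, i != ord_first n_gt0 -> dot (partial i g u) x = 0) ->
    dot w x = a 0 (ord_first n_gt0) * dot (partial (ord_first n_gt0) g u) x.
  by move=> xi; rewrite wa; exact: dot_sum_single.
(* The coefficient of w on the transverse direction is nonzero, because w is
   orthogonal to all the other d_i g and not to itself. *)
have ww : dot w w != 0.
  by apply: contra_neq (support_normal_neq0 c_gt0 pS); exact: dot_eq0.
have /eqP : dot w (g u) = 0 by rewrite gu; exact: support_normal_orth.
rewrite wdot => [|j /edge[] //]; rewrite mulf_eq0 => /orP[/eqP a0|/eqP //].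
suff : dot w w = 0 by move/eqP; rewrite (negbTE ww).
rewrite wdot ?a0 ?mul0r // => j /edge[jg jz].
by apply: support_normal_horizontal; rewrite // -gu.
Unshelve. all: by end_near. Qed.

End Main.

Theorem mainTheorem10 (R : realType) (n : nat) (n_ge2 : (2 <= n)%N)
    (c : R) (c_gt0 : 0 < c) :
  ~ exists (M : manifold R n) (F : M -> ambient R n),
      [/\ [set: M] !=set0,
          immersion F,
          minimal F,
          free_boundary (cone_profile c) F &
          bounded_set (range F) /\ closed (range F)].
Proof.
move=> [M [F [[q _] F_imm F_min F_free [F_bounded F_closed]]]].
have F_compact := bounded_closed_compact_ambient F_bounded F_closed.
have [||_ /set_mem [p _ <-] pmax] :=
    @compact_EVT_max _ R (fun x => dot x x) (range F) _ F_compact.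
- by exists (F q), q.
- exact/continuous_subspaceT/continuous_dot_self.
have n_gt0 : (0 < n)%N by apply: leq_trans n_ge2.
apply: (no_farthest_point n_gt0 c_gt0 F_imm F_min F_free (p := p)) => x.
by apply: pmax; apply/mem_set; exists x.
Qed.
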